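(* Let $p$ be an odd prime and $\lambda\in\mathbb{C}_p$ with $|\lambda|_p<p^{-\frac{1}{p-1}}$. For integers $n,k\ge0$, $$\int_{\mathbb{Z}_p}\int_{\mathbb{Z}_p}B_{k,n}(x_1,x_2|\lambda)\,d\mu_{-1}(x_1)\,d\mu_{-1}(x_2)=\begin{cases}\binom{n}{k}\mathcal{E}_{k,\lambda}\big(2(1)_{n-k,\lambda}+\mathcal{E}_{n-k,\lambda}\big), & \text{if } n>k,\\ \mathcal{E}_{n,\lambda}, & \text{if } n=k.\end{cases}$$
   Context: $\mathbb{C}_p$ is the completion of the algebraic closure of $\mathbb{Q}_p$, with $|p|_p=1/p$. For $x\in\mathbb{C}_p$ define $(x)_{0,\lambda}=1$ and $(x)_{n,\lambda}=x(x-\lambda)\cdots(x-(n-1)\lambda)$ for $n\ge1$. The degenerate Euler polynomials are defined by $\frac{2}{(1+\lambda t)^{1/\lambda}+1}(1+\lambda t)^{x/\lambda}=\sum_{n\ge0}\mathcal{E}_{n,\lambda}(x)\frac{t^n}{n!}$, and $\mathcal{E}_{n,\lambda}=\mathcal{E}_{n,\lambda}(0)$. The two-variable degenerate Bernstein polynomials are $B_{k,n}(x_1,x_2|\lambda)=\binom{n}{k}(x_1)_{k,\lambda}(1-x_2)_{n-k,\lambda}$. For a continuous $f$ on $\mathbb{Z}_p$, the fermionic $p$-adic integral is $\int_{\mathbb{Z}_p}f(x)\,d\mu_{-1}(x)=\lim_{N\to\infty}\sum_{x=0}^{p^N-1}f(x)(-1)^x$. *)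

(* Defs.v *)
From HB Require Import structures.
From mathcomp Require Import all_boot all_order all_algebra.
From mathcomp Require Import all_classical all_reals all_analysis.

Set Implicit Arguments.
Unset Strict Implicit.
Unset Printing Implicit Defensive.

Import Order.TTheory GRing.Theory Num.Theory.
Local Open Scope classical_set_scope.
Local Open Scope ring_scope.

(* Fields with a real absolute value inducing the topology.  MathComp's
   normedZmodType cannot be used for this: it requires
   `|x *+ n| = `|x| *+ n, which no non-archimedean absolute value satisfies.
   The triangle inequality suffices here: the absolute values used below are
   ultrametric because they extend the p-adic one. *)
HB.mixin Record UniformField_hasAbs (R : realType) K
    of GRing.Field K & Uniform K := {
  absv : K -> R ;
  absv_ge0 : forall x, 0 <= absv x ;
  absv_eq0 : forall x, absv x = 0 <-> x = 0 ;
  absvM : forall x y, absv (x * y) = absv x * absv y ;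
  absv_triangle : forall x y, absv (x + y) <= absv x + absv y ;
  absv_entourage :
    @entourage K = entourage_ (fun (x : K) (e : R) => [set y | absv (x - y) < e])
}.

#[short(type="absFieldType")]
HB.structure Definition AbsField (R : realType) :=
  {K of GRing.Field K & Uniform K & UniformField_hasAbs R K}.

#[non_forgetful_inheritance]
HB.instance Definition _ (R : realType) (K : absFieldType R) :=
  isPointed.Build (AbsField.sort K) 0.

Section CompletedFields.
Variable R : realType.

Definition rat_padic_abs (p : nat) (x : rat) : R :=
  if x == 0 then 0
  else p%:R ^+ logn p `|denq x|%N / p%:R ^+ logn p `|numq x|%N.

Definition complete_space (L : absFieldType R) : Prop :=
  forall F : set_system L, ProperFilter F -> cauchy F -> cvg F.

Definition is_completion (K : Type) (absK : K -> R) (L : absFieldType R)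
    (f : K -> L) : Prop :=
  [/\ forall x, absv (f x) = absK x, dense (range f) & complete_space L].

(* Qp is the completion of the rationals for the p-adic absolute value
   (normalised by |p| = 1/p), Qpbar an algebraic closure of Qp with the extended
   absolute value, and Cp the completion of Qpbar; this determines Cp up to
   isometric isomorphism. *)
Record is_Cp (p : nat) (Qp Qpbar Cp : absFieldType R)
    (i : {rmorphism Qp -> Qpbar}) (j : {rmorphism Qpbar -> Cp}) : Prop := {
  Qp_completion : is_completion (rat_padic_abs p) (@ratr Qp) ;
  Qpbar_algebraic : forall z : Qpbar, algebraicOver i z ;
  Qpbar_closed : GRing.closed_field_axiom Qpbar ;
  Qpbar_extends_absv : forall x : Qp, absv (i x) = absv x ;
  Cp_completion : is_completion (@absv R Qpbar) j
}.

Definition padic_integers (Qp : absFieldType R) : set Qp := [set x | absv x <= 1].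

Section FermionicIntegral.
Variables (p : nat) (Qp Cp : absFieldType R).

(* A function on Z_p is given by any extension of it to Q_p; only its values on
   Z_p matter below. *)
Definition fermionic_sum (f : Qp -> Cp) (N : nat) : Cp :=
  \sum_(0 <= x < p ^ N) f x%:R * (-1) ^+ x.

Definition fermionic_integrable (f : Qp -> Cp) : Prop :=
  {within @padic_integers Qp, continuous f} /\ cvgn (fermionic_sum f).

Definition fermionic_integral (f : Qp -> Cp) : Cp := limn (fermionic_sum f).

End FermionicIntegral.
End CompletedFields.

Arguments padic_integers {R} Qp _.

Section Series.
Variable K : fieldType.

(* The sequence a stands for the formal power series \sum_n a n * t ^ n. *)
Definition fps_const (c : K) (n : nat) : K := if n == 0 then c else 0.

Definition fps_add (a b : nat -> K) (n : nat) : K := a n + b n.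

Definition fps_mul (a b : nat -> K) (n : nat) : K :=
  \sum_(m < n.+1) a m * b (n - m)%N.

Fixpoint fps_inv_seq (a : nat -> K) (n : nat) : seq K :=
  if n is m.+1 then
    let s := fps_inv_seq a m in
    rcons s (- (a 0)^-1 * \sum_(l < m.+1) a (m.+1 - l)%N * s`_l)
  else [:: (a 0)^-1].

Definition fps_inv (a : nat -> K) (n : nat) : K := (fps_inv_seq a n)`_n.

Lemma size_fps_inv_seq a n : size (fps_inv_seq a n) = n.+1.
Proof. by elim: n => //= n IHn; rewrite size_rcons IHn. Qed.

Lemma nth_fps_inv_seq a n m : (m <= n)%N -> (fps_inv_seq a n)`_m = fps_inv a m.
Proof.
elim: n => [|n IHn]; first by rewrite leqn0 => /eqP->.
rewrite leq_eqVlt => /orP[/eqP->//|lt_mn].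
by rewrite /= nth_rcons size_fps_inv_seq lt_mn IHn.
Qed.

Lemma fps_mulV a : a 0 != 0 -> fps_mul a (fps_inv a) = fps_const 1.
Proof.
move=> a0; apply/funext => -[|n]; rewrite /fps_mul /fps_const.
  by rewrite big_ord_recl big_ord0 addr0 /fps_inv /= mulfV.
rewrite big_ord_recl subn0 {1}/fps_inv /= nth_rcons size_fps_inv_seq ltnn eqxx.
rewrite mulrA mulrN mulfV // mulN1r addrC; apply/eqP; rewrite subr_eq0; apply/eqP.
rewrite (reindex_inj rev_ord_inj) /=; apply: eq_bigr => l _.
have leln : (l <= n)%N by rewrite -ltnS.
rewrite nth_fps_inv_seq // /bump /= add1n subSS.
by rewrite subSS subKn -?subSn.
Qed.

(* The binomial coefficient y (y - 1) ... (y - n + 1) / n! *)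
Definition gbinom (y : K) (n : nat) : K :=
  (\prod_(m < n) (y - m%:R)) / n`!%:R.

(* (1 + lambda t)^(x / lambda), read as its limit exp(x t) when lambda = 0 *)
Definition degenerate_exp (lambda x : K) (n : nat) : K :=
  if lambda == 0 then x ^+ n / n`!%:R
  else gbinom (x / lambda) n * lambda ^+ n.

Definition degenerate_euler (lambda : K) (n : nat) (x : K) : K :=
  n`!%:R *
  fps_mul
    (fps_mul (fps_const 2)
       (fps_inv (fps_add (degenerate_exp lambda 1) (fps_const 1))))
    (degenerate_exp lambda x) n.

Definition degenerate_ffact (lambda x : K) (n : nat) : K :=
  \prod_(m < n) (x - m%:R * lambda).

Definition degenerate_bernstein (k n : nat) (lambda x1 x2 : K) : K :=
  'C(n, k)%:R * degenerate_ffact lambda x1 k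
    * degenerate_ffact lambda (1 - x2) (n - k).

End Series.

(* Main.v *)
(* If g (x + 1) + g x = 2 f x for all x, then, p being odd, the sum of
   f x (-1)^x over x < p^N telescopes to (g 0 + g (p^N)) / 2, which tends to g 0
   when g is continuous, as p^N tends to 0.  The generating function of the
   degenerate Euler polynomials gives
   E_{n,lambda}(x + 1) + E_{n,lambda}(x) = 2 (x)_{n,lambda}; so f = (x)_{n,lambda}
   admits g = E_{n,lambda}(x), and f = (1 - x)_{n,lambda} admits
   g = E_{n,lambda}(2 - x).  For n > 0 the same relation at x = 0 and x = 1 yields
   E_{n,lambda}(2) = 2 (1)_{n,lambda} + E_{n,lambda}. *)
Require Import Defs.
From HB Require Import structures.
From mathcomp Require Import all_boot all_order all_algebra.
From mathcomp Require Import all_classical all_reals all_analysis.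
From mathcomp Require Import ring lra.

Import Order.TTheory GRing.Theory Num.Theory.
Local Open Scope classical_set_scope.
Local Open Scope ring_scope.

(** * Formal power series and the difference equation of the degenerate Euler polynomials *)

Section PowerSeries.
Variable K : fieldType.
Implicit Types (a b c : nat -> K) (x y lambda : K).

(** Coefficients up to [n] of a Cauchy product depend only on truncations, so commutativity and
    associativity are inherited from [{poly K}]. *)
Let trunc (n : nat) a : {poly K} := \poly_(l < n.+1) a l.

Let fps_mul_trunc n m a b : (m <= n)%N ->
  fps_mul a b m = (trunc n a * trunc n b)`_m.
Proof.
move=> le_mn; rewrite /fps_mul coefM; apply: eq_bigr => l _.
have lel : (l <= m)%N by rewrite -ltnS.
by rewrite !coef_poly !ltnS (leq_trans lel) // (leq_trans (leq_subr _ _)).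
Qed.

Lemma fps_mulC a b : fps_mul a b = fps_mul b a.
Proof. by apply/funext => n; rewrite !(@fps_mul_trunc n) // mulrC. Qed.

Lemma fps_mulA a b c : fps_mul a (fps_mul b c) = fps_mul (fps_mul a b) c.
Proof.
apply/funext => n; transitivity ((trunc n a * (trunc n b * trunc n c))`_n).
  rewrite coefM; apply: eq_bigr => l _.
  by rewrite coef_poly ltn_ord (@fps_mul_trunc n) // leq_subr.
rewrite mulrA coefM; apply: eq_bigr => l _.
rewrite [in trunc n c]/trunc coef_poly ltnS leq_subr.
by rewrite (@fps_mul_trunc n) // -ltnS.
Qed.

Lemma fps_mulDl a b c :
  fps_mul (fps_add a b) c = fps_add (fps_mul a c) (fps_mul b c).
Proof.
apply/funext => n; rewrite /fps_add /fps_mul -big_split.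
by apply: eq_bigr => l _; rewrite mulrDl.
Qed.

Lemma fps_constM (u : K) a n : fps_mul (fps_const u) a n = u * a n.
Proof.
rewrite /fps_mul big_ord_recl /= subn0 big1 ?addr0 // => l _.
by rewrite /fps_const /= mul0r.
Qed.

Lemma degenerate_ffactS lambda x n :
  degenerate_ffact lambda x n.+1 =
  degenerate_ffact lambda x n * (x - n%:R * lambda).
Proof. exact: big_ord_recr. Qed.

(** The Chu-Vandermonde identity with step [lambda], proved like the binomial theorem, by induction
    and Pascal's rule. *)
Lemma degenerate_ffactD lambda x y n :
  degenerate_ffact lambda (x + y) n =
  \sum_(m < n.+1) 'C(n, m)%:R *
    (degenerate_ffact lambda x m * degenerate_ffact lambda y (n - m)).
Proof.
elim: n => [|n IHn].
  by rewrite big_ord_recl big_ord0 /degenerate_ffact !big_ord0 bin0 !mulr1 addr0.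
pose d := degenerate_ffact lambda.
rewrite degenerate_ffactS IHn mulr_suml.
(* The new factor is (y - (n - m) lambda) + (x - m lambda); each part extends one of the two
   products. *)
have split_term (m : 'I_n.+1) :
    'C(n, m)%:R * (d x m * d y (n - m)%N) * (x + y - n%:R * lambda) =
    'C(n, m)%:R * (d x m * d y (n.+1 - m)%N) +
    'C(n, m)%:R * (d x m.+1 * d y (n - m)%N).
  have lemn : (m <= n)%N by rewrite -ltnS.
  rewrite subSn // /d !degenerate_ffactS.
  have -> : n%:R = m%:R + (n - m)%:R :> K by rewrite -natrD subnKC.
  ring.
rewrite (eq_bigr _ (fun m _ => split_term m)) big_split /=.
rewrite [RHS]big_ord_recl bin0 subn0.
under [X in _ = _ + X]eq_bigr => l _ do
  rewrite lift0 binS natrD mulrDl subSS.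
rewrite big_split /= [in RHS]addrA; congr (_ + _).
rewrite [LHS]big_ord_recl bin0 subn0; congr (_ + _).
(* The surplus top term left by Pascal's rule carries C(n, n+1) = 0. *)
rewrite [RHS]big_ord_recr /= bin_small // mul0r addr0.
by apply: eq_bigr => l _.
Qed.

Hypothesis natr_neq0 : forall n : nat, n.+1%:R != 0 :> K.

Let fact_neq0 n : n`!%:R != 0 :> K.
Proof. by rewrite -(prednK (fact_gt0 n)). Qed.

(** Merges the cases [lambda = 0] and [lambda != 0], and shows that each coefficient is a polynomial
    in [x]. *)
Lemma degenerate_expE lambda x n :
  degenerate_exp lambda x n = degenerate_ffact lambda x n / n`!%:R.
Proof.
rewrite /degenerate_exp /degenerate_ffact; case: eqP => [->|/eqP lambda0].
  under eq_bigr => m _ do rewrite mulr0 subr0.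
  by rewrite prodr_const card_ord.
rewrite /gbinom mulrAC; congr (_ / _).
have -> : lambda ^+ n = \prod_(m < n) lambda by rewrite prodr_const card_ord.
rewrite -big_split /=.
by apply: eq_bigr => m _; rewrite mulrBl divfK.
Qed.

(** This is [degenerate_ffactD] divided by n!. *)
Lemma degenerate_expD lambda x y :
  degenerate_exp lambda (x + y) =
  fps_mul (degenerate_exp lambda x) (degenerate_exp lambda y).
Proof.
apply/funext => n; rewrite degenerate_expE degenerate_ffactD mulr_suml.
apply: eq_bigr => m _; rewrite !degenerate_expE.
have lemn : (m <= n)%N by rewrite -ltnS.
have -> : n`!%:R = 'C(n, m)%:R * (m`!%:R * (n - m)`!%:R) :> K.
  by rewrite -!natrM bin_fact.
have bin0 : 'C(n, m)%:R != 0 :> K.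
  by rewrite -(prednK (_ : 0 < 'C(n, m))%N) // bin_gt0.
by field; rewrite bin0 !fact_neq0.
Qed.

(** Replacing x by x + 1 multiplies the generating function by e(1) = (1 + lambda t)^(1/lambda).
    Adding the two series thus produces the factor e(1) + 1, which cancels the denominator and
    leaves twice the series of (x)_{n,lambda}. *)
Lemma degenerate_eulerD1 lambda x n :
  degenerate_euler lambda n (x + 1) + degenerate_euler lambda n x =
  2 * degenerate_ffact lambda x n.
Proof.
(* The constant term of the denominator is 1 + 1, which is nonzero, so [fps_mulV] applies. *)
have D0 : fps_add (degenerate_exp lambda 1) (fps_const 1) 0 != 0.
  rewrite /fps_add degenerate_expE /degenerate_ffact big_ord0 divr1 /fps_const.
  exact: (natr_neq0 1).
rewrite /degenerate_euler -mulrDr addrC [x + 1]addrC degenerate_expD.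
set D := fps_add _ _ in D0 *; set c := fps_mul (fps_const 2) _.
set e := degenerate_exp lambda x.
have -> : fps_mul c e n + fps_mul c (fps_mul (degenerate_exp lambda 1) e) n =
          fps_mul c (fps_mul D e) n.
  rewrite fps_mulDl [in RHS]fps_mulC /fps_add !(fps_mulC c) addrC.
  rewrite -/(fps_add _ _ n) -fps_mulDl.
  by congr (fps_mul (fps_add _ _) c n); apply/funext => m; rewrite fps_constM mul1r.
rewrite fps_mulA -(fps_mulA (fps_const 2)) (fps_mulC _ D) fps_mulV //.
rewrite -fps_mulA !fps_constM mul1r /e degenerate_expE mulrCA; congr (_ * _).
by rewrite mulrCA divff ?mulr1.
Qed.

(** The generating function has constant term 2 / (1 + 1). This settles the case n = k, where the
    outer integral is a value of E_0. *)
Lemma degenerate_euler0 lambda x : degenerate_euler lambda 0 x = 1.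
Proof.
have D0 : fps_add (degenerate_exp lambda 1) (fps_const 1) 0 = 2.
  by rewrite /fps_add degenerate_expE /degenerate_ffact big_ord0 divr1.
rewrite /degenerate_euler /fps_mul !(big_ord_recl, big_ord0) !addr0 /=.
rewrite /fps_inv /= D0 degenerate_expE /degenerate_ffact big_ord0 /fps_const /=.
by rewrite !divr1 mul1r mulr1 mulfV // (natr_neq0 1).
Qed.

Lemma alternating_sum (f g : K -> K) (M : nat) :
    (forall x, g (x + 1) + g x = 2 * f x) -> odd M ->
  \sum_(0 <= l < M) f l%:R * (-1) ^+ l = 2^-1 * (g 0 + g M%:R).
Proof.
move=> fg oddM; apply: (mulfI (natr_neq0 1)).
rewrite mulrA mulfV ?(natr_neq0 1) // mul1r.
(* Keeping the sign (-1)^M gives a formula valid for all [M], which is what the induction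
   requires. *)
suff -> : 2 * (\sum_(0 <= l < M) f l%:R * (-1) ^+ l) = g 0 - (-1) ^+ M * g M%:R.
  by rewrite -signr_odd oddM expr1 mulN1r opprK.
elim: M {oddM} => [|M IHM]; first by rewrite big_nil mulr0 expr0 mul1r subrr.
rewrite big_nat_recr //= mulrDr IHM mulrA -fg exprS -natr1; ring.
Qed.

End PowerSeries.

(** * Limits and continuity in a field with absolute value *)

Section AbsFieldTopology.
Variables (R : realType) (K : absFieldType R).
Implicit Types x y : K.

Lemma absv0 : absv (0 : K) = 0.
Proof. exact/absv_eq0. Qed.

Lemma absv_gt0 x : x != 0 -> 0 < absv x.
Proof.
by move=> x0; rewrite lt_neqAle absv_ge0 andbT eq_sym; apply: contraNN x0 =>
  /eqP/absv_eq0 ->.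
Qed.

Lemma absv1 : absv (1 : K) = 1.
Proof.
apply: (@mulfI _ (absv (1 : K))); last by rewrite -absvM !mulr1.
exact/lt0r_neq0/absv_gt0/oner_neq0.
Qed.

(** [absv (-1)] is nonnegative and its square is [absv 1 = 1]. *)
Lemma absvN x : absv (- x) = absv x.
Proof.
suff N1 : absv (-1 : K) = 1 by rewrite -mulN1r absvM N1 mul1r.
apply/eqP; rewrite -(@eqrXn2 _ 2) ?absv_ge0 // expr1n expr2 -absvM.
by rewrite mulrNN mulr1 absv1.
Qed.

Lemma absv_distC x y : absv (x - y) = absv (y - x).
Proof. by rewrite -absvN opprB. Qed.

Lemma nbhs_absvP x (A : set K) :
  nbhs x A <-> exists2 e : R, 0 < e & forall y, absv (x - y) < e -> A y.
Proof.
split=> [/nbhsP[E entE EA]|[e e0 eA]].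
  move: entE; rewrite absv_entourage => -[e e0 eE]; exists e => // y xy.
  by apply: EA; apply/xsectionP; apply: eE.
apply/nbhsP; exists [set xy | absv (xy.1 - xy.2) < e].
  by rewrite absv_entourage; exists e.
by move=> y /xsectionP; exact: eA.
Qed.

Lemma cvg_absvP (T : Type) (F : set_system T) (FF : Filter F) (f : T -> K) x :
  f @ F --> x <-> forall e : R, 0 < e -> \forall t \near F, absv (x - f t) < e.
Proof.
split=> [fx e e0|fx A /nbhs_absvP[e e0 eA]].
  by apply: (fx [set y | absv (x - y) < e]); apply/nbhs_absvP; exists e.
by apply: filterS (fx e e0) => t; exact: eA.
Qed.

(** Gives uniqueness of limits, so that [lim] can be computed by exhibiting a limit. Two balls of
    radius half the distance between their centres are disjoint. *)
Lemma absv_hausdorff : hausdorff_space K.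
Proof.
move=> x y clxy; apply/eqP/negPn/negP => xy.
have e0 : 0 < absv (x - y) / 2 by rewrite divr_gt0 // absv_gt0 // subr_eq0.
have [||z [/= xz yz]] := clxy [set z | absv (x - z) < absv (x - y) / 2]
  [set z | absv (y - z) < absv (x - y) / 2].
- by apply/nbhs_absvP; exists (absv (x - y) / 2).
- by apply/nbhs_absvP; exists (absv (x - y) / 2).
have := absv_triangle (x - z) (z - y); rewrite (absv_distC z) addrA subrK => h.
lra.
Qed.

Section Limits.
Variables (T : Type) (F : set_system T) (FF : Filter F).
Implicit Types f g : T -> K.

Lemma cvg_absvD f g x y :
  f @ F --> x -> g @ F --> y -> (fun t => f t + g t) @ F --> x + y.
Proof.
move=> /cvg_absvP fx /cvg_absvP gy; apply/cvg_absvP => e e0.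
have e20 : 0 < e / 2 by rewrite divr_gt0.
apply: filterS2 (fx _ e20) (gy _ e20) => t ft gt.
have := absv_triangle (x - f t) (y - g t); rewrite addrACA -opprD => h; lra.
Qed.

Lemma cvg_absvM f g x y :
  f @ F --> x -> g @ F --> y -> (fun t => f t * g t) @ F --> x * y.
Proof.
move=> /cvg_absvP fx /cvg_absvP gy; apply/cvg_absvP => e e0.
have x0 := absv_ge0 x; have y0 := absv_ge0 y.
(* With both errors below [d <= 1], the error of the product is less than d |x| + d (|y| + 1) <=
   e. *)
pose d := Num.min 1 (e / (absv x + absv y + 1)).
have c0 : 0 < absv x + absv y + 1 by lra.
have d0 : 0 < d by rewrite lt_min ltr01 divr_gt0.
apply: filterS2 (fx _ d0) (gy _ d0) => t.
set u := absv (x - f t); set v := absv (y - g t) => ud vd.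
have d1 : d <= 1 by rewrite ge_min lexx.
have de : d * (absv x + absv y + 1) <= e.
  by rewrite -ler_pdivlMr // ge_min lexx orbT.
have u0 : 0 <= u := absv_ge0 _; have v0 : 0 <= v := absv_ge0 _.
have -> : x * y - f t * g t = x * (y - g t) + (x - f t) * (y - (y - g t)) by ring.
have h1 := absv_triangle (x * (y - g t)) ((x - f t) * (y - (y - g t))).
rewrite !absvM -/u -/v in h1.
have h2 := absv_triangle y (- (y - g t)); rewrite absvN -/v in h2.
nra.
Qed.

Lemma cvg_absv_cst x : (fun _ : T => x) @ F --> x.
Proof.
by apply/cvg_absvP => e e0; apply: filterE => t; rewrite subrr absv0.
Qed.

Lemma cvg_absvN f x : f @ F --> x -> (fun t => - f t) @ F --> - x.
Proof.
move=> fx; rewrite -mulN1r; under eq_fun do rewrite -mulN1r.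
by apply: cvg_absvM fx; exact: cvg_absv_cst.
Qed.

Lemma cvg_absvB f g x y :
  f @ F --> x -> g @ F --> y -> (fun t => f t - g t) @ F --> x - y.
Proof. by move=> fx gy; apply: cvg_absvD fx _; exact: cvg_absvN. Qed.

Lemma cvg_degenerate_ffact lambda n f x : f @ F --> x ->
  (fun t => degenerate_ffact lambda (f t) n) @ F --> degenerate_ffact lambda x n.
Proof.
move=> fx; elim: n => [|n IHn].
  under eq_fun do rewrite /degenerate_ffact big_ord0.
  by rewrite /degenerate_ffact big_ord0; exact: cvg_absv_cst.
under eq_fun do rewrite degenerate_ffactS.
rewrite degenerate_ffactS; apply: cvg_absvM IHn _.
by apply: cvg_absvB fx _; exact: cvg_absv_cst.
Qed.

(** E_{n,lambda}(x) is a finite combination of the (x)_{m,lambda} with coefficients independent of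
    x. *)
Lemma cvg_degenerate_euler lambda n f x :
    (forall m : nat, m.+1%:R != 0 :> K) -> f @ F --> x ->
  (fun t => degenerate_euler lambda n (f t)) @ F --> degenerate_euler lambda n x.
Proof.
move=> K0 fx; apply: cvg_absvM; first exact: cvg_absv_cst.
rewrite /fps_mul; elim: (index_enum _) => [|l s IHs].
  by under eq_fun do rewrite big_nil; rewrite big_nil; exact: cvg_absv_cst.
under eq_fun do rewrite big_cons.
rewrite big_cons; apply: cvg_absvD IHs; apply: cvg_absvM.
  exact: cvg_absv_cst.
under eq_fun do rewrite degenerate_expE //.
rewrite degenerate_expE //; apply: cvg_absvM; last exact: cvg_absv_cst.
exact: cvg_degenerate_ffact.
Qed.

End Limits.

End AbsFieldTopology.

Lemma isometry_continuous (R : realType) (L K : absFieldType R)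
    (h : {rmorphism L -> K}) :
  (forall z, absv (h z) = absv z) -> continuous h.
Proof.
move=> hE x; apply/cvg_absvP => e e0.
apply/nbhs_absvP; exists e => // y.
by rewrite -rmorphB hE.
Qed.

(** * Fermionic integrals of degenerate falling factorials *)

Section PadicNumbers.
Variables (R : realType) (p : nat) (Qp Qpbar Cp : absFieldType R).
Variables (i : {rmorphism Qp -> Qpbar}) (j : {rmorphism Qpbar -> Cp}).
Hypotheses (hp : prime p) (hodd : odd p) (hCp : is_Cp p i j).

Lemma absv_Qp_Cp (x : Qp) : absv (j (i x)) = absv x.
Proof.
have [jE _ _] := Cp_completion hCp.
by rewrite jE (Qpbar_extends_absv hCp).
Qed.

(** The integer comes from the rationals, and every embedding up to [Cp] preserves the absolute
    value. *)
Lemma absv_natr (m : nat) : absv (m.+1%:R : Cp) = (p%:R ^+ logn p m.+1)^-1.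
Proof.
have [rE _ _] := Qp_completion hCp.
have -> : m.+1%:R = j (i (ratr m.+1%:R)) :> Cp by rewrite ratr_nat !rmorph_nat.
rewrite absv_Qp_Cp rE /rat_padic_abs pnatr_eq0 /=.
by rewrite -[m.+1%:R]/(m.+1%:~R) numq_int denq_int logn1 expr0 div1r.
Qed.

Lemma Cp_natr_neq0 (m : nat) : m.+1%:R != 0 :> Cp.
Proof.
apply/negP => /eqP m0; have := absv_natr m; rewrite m0 absv0 => /esym/eqP.
by rewrite invr_eq0 expf_eq0 pnatr_eq0 (negPf (lt0n_neq0 (prime_gt0 hp))) andbF.
Qed.

(** The absolute value of p^N is (1/p)^N, a geometric sequence of ratio less than 1. *)
Lemma cvg_pX : (fun N => (p ^ N)%:R : Cp) @ \oo --> (0 : Cp).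
Proof.
apply/cvg_absvP => e e0.
have pV : `|(p%:R : R)^-1| < 1.
  rewrite ger0_norm ?invr_ge0 // invf_lt1 ?ltr0n ?ltr1n ?prime_gt0 //.
  exact: prime_gt1.
have /cvgrPdist_lt/(_ e e0) := cvg_expr pV; apply: filterS => N /=.
rewrite !sub0r normrN absvN -(prednK (_ : 0 < p ^ N)%N) ?expn_gt0 ?prime_gt0 //.
rewrite absv_natr prednK ?expn_gt0 ?prime_gt0 // pfactorK // exprVn.
by rewrite ger0_norm // invr_ge0 exprn_ge0.
Qed.

(** Factoring [f] through [F] on [Cp] turns the functional equation into pure algebra. Continuity of
    [g] is asked along sequences tending to 0, to be applied to p^N. *)
Lemma cvg_fermionic_sum (f : Qp -> Cp) (F g : Cp -> Cp) :
    (forall x, f x = F (j (i x))) ->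
    (forall x, g (x + 1) + g x = 2 * F x) ->
    (forall u : nat -> Cp, u @ \oo --> (0 : Cp) -> (g \o u) @ \oo --> g 0) ->
  fermionic_sum p f @ \oo --> g 0.
Proof.
move=> fF Fg gc.
have -> : fermionic_sum p f = fun N => 2^-1 * (g 0 + g (p ^ N)%:R).
  apply/funext => N; rewrite -(alternating_sum _ Cp_natr_neq0 F) ?oddX ?hodd ?orbT //.
  by apply: eq_bigr => l _; rewrite fF !rmorph_nat.
have halves : 2^-1 * (g 0 + g 0) = g 0.
  by rewrite -mulr2n -[g 0 *+ 2]mulr_natl mulKf // (Cp_natr_neq0 1).
rewrite -[X in _ --> X]halves.
apply: cvg_absvM; first exact: cvg_absv_cst.
apply: cvg_absvD; first exact: cvg_absv_cst.
exact: gc cvg_pX.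
Qed.

Lemma fermionic_integralP (f : Qp -> Cp) (F g : Cp -> Cp) :
    (forall x, f x = F (j (i x))) ->
    (forall x, g (x + 1) + g x = 2 * F x) ->
    (forall u : nat -> Cp, u @ \oo --> (0 : Cp) -> (g \o u) @ \oo --> g 0) ->
    continuous f ->
  fermionic_integrable p f /\ fermionic_integral p f = g 0.
Proof.
move=> fF Fg gc fc; have fg := cvg_fermionic_sum f F g fF Fg gc.
split; last exact: (cvg_lim (@absv_hausdorff _ _) fg).
by split; [exact: continuous_subspaceT | exact: cvgP fg].
Qed.

Lemma continuous_Qp_Cp : continuous (fun x : Qp => j (i x)).
Proof.
exact: (@isometry_continuous _ _ _ (j \o i : {rmorphism Qp -> Cp}) absv_Qp_Cp).
Qed.

(** The constants [c] and [d] receive the binomial coefficient and the factor in x2, fixed during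
    the inner integration. *)
Lemma fermionic_integral_ffact (lambda c d : Cp) (n : nat)
    (f := fun x : Qp => c * degenerate_ffact lambda (j (i x)) n * d) :
  fermionic_integrable p f /\
  fermionic_integral p f = c * degenerate_euler lambda n 0 * d.
Proof.
apply: (@fermionic_integralP f (fun y => c * degenerate_ffact lambda y n * d)
  (fun y => c * degenerate_euler lambda n y * d)) => // [x|u u0|x].
- by rewrite -mulrDl -mulrDr degenerate_eulerD1; [ring | exact: Cp_natr_neq0].
- apply: cvg_absvM; last exact: cvg_absv_cst.
  apply: cvg_absvM; first exact: cvg_absv_cst.
  by apply: cvg_degenerate_euler u0; exact: Cp_natr_neq0.
- apply: cvg_absvM; last exact: cvg_absv_cst.
  apply: cvg_absvM; first exact: cvg_absv_cst.
  by apply: cvg_degenerate_ffact; exact: continuous_Qp_Cp.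
Qed.

Lemma fermionic_integral_ffact1B (lambda c : Cp) (n : nat)
    (f := fun x : Qp => c * degenerate_ffact lambda (1 - j (i x)) n) :
  fermionic_integrable p f /\
  fermionic_integral p f = c * degenerate_euler lambda n 2.
Proof.
(* The value at 0 of y -> E_{n,lambda}(2 - y) appears as E_{n,lambda}(2 - 0). *)
rewrite -[X in degenerate_euler _ _ X]subr0.
apply: (@fermionic_integralP f (fun y => c * degenerate_ffact lambda (1 - y) n)
  (fun y => c * degenerate_euler lambda n (2 - y))) => // [x|u u0|x].
- have -> : 2 - (x + 1) = 1 - x :> Cp by ring.
  have -> : 2 - x = 1 - x + 1 :> Cp by ring.
  rewrite -mulrDr [X in c * X]addrC degenerate_eulerD1; first ring.
  exact: Cp_natr_neq0.
- apply: cvg_absvM; first exact: cvg_absv_cst.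
  apply: cvg_degenerate_euler; first exact: Cp_natr_neq0.
  by apply: cvg_absvB u0; exact: cvg_absv_cst.
- apply: cvg_absvM; first exact: cvg_absv_cst.
  apply: cvg_degenerate_ffact; apply: cvg_absvB; first exact: cvg_absv_cst.
  exact: continuous_Qp_Cp.
Qed.

Lemma degenerate_euler2 (lambda : Cp) (n : nat) :
  degenerate_euler lambda n.+1 2 =
  2 * degenerate_ffact lambda 1 n.+1 + degenerate_euler lambda n.+1 0.
Proof.
(* The factor of index 0 vanishes; for an empty product this would fail, hence the index [n.+1]. The
   relation at 0 then gives E(1) = -E(0), to be inserted in the relation at 1. *)
have ffact0 : degenerate_ffact lambda 0 n.+1 = 0.
  by rewrite /degenerate_ffact big_ord_recl mul0r subr0 mul0r.
have := degenerate_eulerD1 _ Cp_natr_neq0 lambda 0 n.+1.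
have := degenerate_eulerD1 _ Cp_natr_neq0 lambda 1 n.+1.
rewrite ffact0 mulr0 add0r => <- /eqP; rewrite addr_eq0 => /eqP ->.
by rewrite addrNK.
Qed.

End PadicNumbers.

(** * The iterated integral of the degenerate Bernstein polynomials *)

Theorem theorem2p9 (R : realType) (p : nat) (Qp Qpbar Cp : absFieldType R)
    (i : {rmorphism Qp -> Qpbar}) (j : {rmorphism Qpbar -> Cp})
    (hp : prime p) (hodd : odd p) (hCp : is_Cp p i j)
    (lambda : Cp)
    (hlambda : absv lambda < (p%:R : R) `^ (- (1 / (p%:R - 1))))
    (n k : nat) (hkn : (k <= n)%N) :
  let B : Qp -> Qp -> Cp :=
    fun x1 x2 => degenerate_bernstein k n lambda (j (i x1)) (j (i x2)) in
  [/\ forall x2 : Qp, padic_integers Qp x2 -> fermionic_integrable p (fun x1 : Qp => B x1 x2),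
      fermionic_integrable p
        (fun x2 : Qp => fermionic_integral p (fun x1 : Qp => B x1 x2)) &
      fermionic_integral p
        (fun x2 : Qp => fermionic_integral p (fun x1 : Qp => B x1 x2)) =
      if (k < n)%N then
        'C(n, k)%:R * degenerate_euler lambda k 0 *
          (2 * degenerate_ffact lambda 1 (n - k)
             + degenerate_euler lambda (n - k) 0)
      else degenerate_euler lambda n 0].
Proof.
move=> B; have int1 x2 := fermionic_integral_ffact _ _ _ _ _ _ _ hp hodd hCp lambda
  'C(n, k)%:R (degenerate_ffact lambda (1 - j (i x2)) (n - k)) k.
have [int2 int2E] := fermionic_integral_ffact1B _ _ _ _ _ _ _ hp hodd hCp lambda
  ('C(n, k)%:R * degenerate_euler lambda k 0) (n - k).
(* The inner integral is evaluated at every [x2], which makes the outer integrand an explicit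
   function. *)
have -> : (fun x2 => fermionic_integral p (fun x1 => B x1 x2)) = fun x2 =>
    'C(n, k)%:R * degenerate_euler lambda k 0 *
      degenerate_ffact lambda (1 - j (i x2)) (n - k).
  by apply/funext => x2; rewrite (int1 x2).2.
split=> // [x2 _|]; first exact: (int1 x2).1.
rewrite int2E; case: ltnP => [ltkn|lenk].
  by rewrite -(prednK (_ : 0 < n - k)%N) ?subn_gt0 // (degenerate_euler2 _ _ _ _ _ _ _ hp hCp).
(* Here the outer integral contributes E_0(2) = 1 and the binomial coefficient is 1. *)
have -> : k = n by apply/eqP; rewrite eqn_leq hkn.
by rewrite subnn binn mul1r (degenerate_euler0 _ (Cp_natr_neq0 _ _ _ _ _ _ _ hp hCp)) mulr1.
Qed.
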